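(* Let $\{\Gamma_s\}_{s\in S}$, $|S|\geq2$, be a family of non-trivial groups and let $\Gamma=\ast_{s\in S}\Gamma_s$ be the associated free product. The map $V_0(\Gamma)\rightarrow\mathrm{EH}^2_{\mathrm{b}}(\Gamma,\mathbb{R})$ given by $\sigma\mapsto[\partial g_\sigma]_{\mathrm{b}}$ is a linear injection.
   Context: Bounded cohomology: for a group $\Gamma$, let $C^n(\Gamma)$ be the space of maps $\Gamma^n\to\mathbb{R}$ and $C^n_{\mathrm{b}}(\Gamma)$ the subspace of bounded maps. The coboundary maps (trivial real coefficients) are, in the relevant degrees, $\partial f(x,y)=f(y)-f(xy)+f(x)$ for $f\in C^1(\Gamma)$ and $\partial f(x,y,z)=f(y,z)-f(xy,z)+f(x,yz)-f(x,y)$ for $f\in C^2(\Gamma)$. Then $\mathrm{H}^2_{\mathrm{b}}(\Gamma,\mathbb{R})=\ker(\partial:C^2_{\mathrm{b}}(\Gamma)\to C^3_{\mathrm{b}}(\Gamma))/\mathrm{im}(\partial:C^1_{\mathrm{b}}(\Gamma)\to C^2_{\mathrm{b}}(\Gamma))$, $[\,\cdot\,]_{\mathrm{b}}$ denotes the class of a bounded 2-cocycle, and $\mathrm{H}^2(\Gamma,\mathbb{R})$ is defined in the same way from $C^*(\Gamma)$. $\mathrm{EH}^2_{\mathrm{b}}(\Gamma,\mathbb{R})$ is the kernel of the comparison map $\mathrm{H}^2_{\mathrm{b}}(\Gamma,\mathbb{R})\to\mathrm{H}^2(\Gamma,\mathbb{R})$ induced by the inclusion $C^*_{\mathrm{b}}(\Gamma)\hookrightarrow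 C^*(\Gamma)$. A map $f:\Gamma\to\mathbb{R}$ is a quasi-morphism if $\sup_{x,y\in\Gamma}|f(x)+f(y)-f(xy)|<\infty$; then $\partial f$ is a bounded 2-cocycle and $[\partial f]_{\mathrm{b}}\in\mathrm{EH}^2_{\mathrm{b}}(\Gamma,\mathbb{R})$. For a group $H$, $\widehat{C}^1_{\mathrm{b}}(H)$ denotes the space of bounded odd maps $f:H\to\mathbb{R}$, where odd means $f(x^{-1})=-f(x)$ for all $x\in H$. Set $V(\Gamma):=\prod_{s\in S}\widehat{C}^1_{\mathrm{b}}(\Gamma_s)$ and $V_0(\Gamma):=\{(\sigma_s)_{s\in S}\in V(\Gamma)\,;\,\sup_{s\in S}\|\sigma_s\|_\infty<\infty\}$. Each $\Gamma_s$ is identified with its image under the natural map $\Gamma_s\hookrightarrow\Gamma$. The factorization of $x\in\Gamma$ is the unique way of writing $x=x_0\cdots x_n$ with $x_i\in\Gamma_{s_i}$ non-trivial and $s_i\neq s_{i+1}$ for $0\le i<n$ (the neutral element has the empty factorization). For $\sigma\in V_0(\Gamma)$ and $x$ with this factorization, $g_\sigma(x)=\sum_{i=0}^n\sigma_{s_i}(x_i)$ (so $g_\sigma$ vanishes at the neutral element). Each $g_\sigma$ is a quasi-morphism. *)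

(* Defs.v *)
From HB Require Import structures.
From mathcomp Require Import all_boot all_order all_algebra.
From mathcomp Require Import ring_quotient all_classical reals.
From mathcomp Require Import ring lra.

Set Implicit Arguments.
Unset Strict Implicit.
Unset Printing Implicit Defensive.

Import Order.TTheory GRing.Theory Num.Theory.
Local Open Scope ring_scope.

Section Subspace.
Variables (R : pzRingType) (V : lmodType R) (P : submodClosed V).

Definition subspace := {v : V | v \in P}.

HB.instance Definition _ := SubChoice.on subspace.
HB.instance Definition _ := [SubChoice_isSubLmodule of subspace by <:].

End Subspace.

Section Kernel.
Variables (R : pzRingType) (V W : lmodType R) (f : {linear V -> W}).

Definition in_ker : {pred V} := fun v => f v == 0.

Lemma in_kerE v : (v \in in_ker) = (f v == 0). Proof. by []. Qed.

Lemma in_ker_closed : subsemimod_closed in_ker.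
Proof.
split; first split.
- by rewrite in_kerE raddf0.
- by move=> u v; rewrite !in_kerE => /eqP fu /eqP fv; rewrite linearD fu fv addr0.
- by move=> a v; rewrite !in_kerE => /eqP fv; rewrite linearZ /= fv scaler0.
Qed.

HB.instance Definition _ := GRing.isSubmodClosed.Build R V in_ker in_ker_closed.

Definition ker := subspace in_ker.
HB.instance Definition _ := GRing.SubLmodule.on ker.

End Kernel.

Section Quotient.
Local Open Scope quotient_scope.
Variables (R : pzRingType) (V : lmodType R) (I : submodClosed V).

(* zmodClosed is not inferred from submodClosed (defined over semirings). *)
Definition zmod_pred : {pred V} := fun v => v \in I.

Lemma zmod_pred_closed : zmod_closed zmod_pred.
Proof.
split=> [|x y xI yI]; first exact: rpred0.
by rewrite -scaleN1r; apply: rpredD => //; apply: rpredZ.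
Qed.
HB.instance Definition _ := GRing.isZmodClosed.Build V zmod_pred zmod_pred_closed.

Definition quotient := Quotient.quot zmod_pred.
HB.instance Definition _ := ZmodQuotient.on quotient.

Definition proj : V -> quotient := \pi_quotient.

Lemma projP x y : (proj x = proj y) <-> x - y \in I.
Proof.
rewrite /proj -[_ \in I]/(x - y \in zmod_pred) Quotient.idealrBE.
by split=> [->|/eqP].
Qed.

Lemma projK c : proj (repr c) = c. Proof. exact: reprK. Qed.

Definition quotient_scale (a : R) (c : quotient) : quotient :=
  proj (a *: repr c).

Lemma proj_scale a x : quotient_scale a (proj x) = proj (a *: x).
Proof.
apply/projP; rewrite -scalerBr.
by apply: rpredZ; apply/projP; rewrite projK.
Qed.

Lemma projD x y : proj (x + y) = proj x + proj y.
Proof. exact: (raddfD \pi_quotient). Qed.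

Lemma quotient_scalerA a b c :
  quotient_scale a (quotient_scale b c) = quotient_scale (a * b) c.
Proof. by rewrite -[c]projK !proj_scale scalerA. Qed.

Lemma quotient_scale1r : left_id 1 quotient_scale.
Proof. by move=> c; rewrite -[c]projK proj_scale scale1r. Qed.

Lemma quotient_scalerDr : right_distributive quotient_scale +%R.
Proof.
move=> a c d; rewrite -[c]projK -[d]projK -projD !proj_scale scalerDr.
by rewrite projD.
Qed.

Lemma quotient_scalerDl c : {morph quotient_scale^~ c : a b / a + b}.
Proof. by move=> a b; rewrite -[c]projK !proj_scale scalerDl projD. Qed.

HB.instance Definition _ := GRing.Zmodule_isLmodule.Build R quotient
  quotient_scalerA quotient_scale1r quotient_scalerDr quotient_scalerDl.

Lemma proj_linear : linear proj.
Proof. by move=> a x y; rewrite projD -proj_scale. Qed.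
HB.instance Definition _ :=
  GRing.isLinear.Build R V quotient *:%R proj proj_linear.

End Quotient.

Section DependentProduct.
Variables (R : pzRingType) (I : Type) (V : I -> lmodType R).

Definition dprod := forall i, V i.

HB.instance Definition _ := Choice.on dprod.

Definition dprod_zero : dprod := fun i => 0.
Definition dprod_opp (f : dprod) : dprod := fun i => - f i.
Definition dprod_add (f g : dprod) : dprod := fun i => f i + g i.
Definition dprod_scale (a : R) (f : dprod) : dprod := fun i => a *: f i.

Lemma dprod_addA : associative dprod_add.
Proof. by move=> f g h; apply: functional_extensionality_dep => i; apply: addrA. Qed.
Lemma dprod_addC : commutative dprod_add.
Proof. by move=> f g; apply: functional_extensionality_dep => i; apply: addrC. Qed.
Lemma dprod_add0 : left_id dprod_zero dprod_add.
Proof. by move=> f; apply: functional_extensionality_dep => i; apply: add0r. Qed.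
Lemma dprod_addN : left_inverse dprod_zero dprod_opp dprod_add.
Proof. by move=> f; apply: functional_extensionality_dep => i; apply: addNr. Qed.
HB.instance Definition _ := GRing.isZmodule.Build dprod
  dprod_addA dprod_addC dprod_add0 dprod_addN.

Lemma dprod_scaleA a b f :
  dprod_scale a (dprod_scale b f) = dprod_scale (a * b) f.
Proof. by apply: functional_extensionality_dep => i; apply: scalerA. Qed.
Lemma dprod_scale1 : left_id 1 dprod_scale.
Proof. by move=> f; apply: functional_extensionality_dep => i; apply: scale1r. Qed.
Lemma dprod_scaleDr : right_distributive dprod_scale +%R.
Proof. by move=> a f g; apply: functional_extensionality_dep => i; apply: scalerDr. Qed.
Lemma dprod_scaleDl f : {morph dprod_scale^~ f : a b / a + b}.
Proof. by move=> a b; apply: functional_extensionality_dep => i; apply: scalerDl. Qed.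
HB.instance Definition _ := GRing.Zmodule_isLmodule.Build R dprod
  dprod_scaleA dprod_scale1 dprod_scaleDr dprod_scaleDl.

End DependentProduct.

(* Homology at V of U --d--> V --d'--> W. *)
Section Homology.
Variables (R : pzRingType) (U V W : lmodType R).
Variables (d : {linear U -> V}) (d' : {linear V -> W}).

Definition is_boundary : {pred ker d'} := fun z => `[< exists u, d u = val z >].

Lemma is_boundary_closed : subsemimod_closed is_boundary.
Proof.
split; first split.
- by apply/asboolP; exists 0; rewrite !raddf0.
- move=> x y /asboolP[u ux] /asboolP[v vy]; apply/asboolP; exists (u + v).
  by rewrite !raddfD /= ux vy.
- move=> a x /asboolP[u ux]; apply/asboolP; exists (a *: u).
  by rewrite !linearZ /= ux.
Qed.
HB.instance Definition _ :=
  GRing.isSubmodClosed.Build R (ker d') is_boundary is_boundary_closed.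

Definition homology := quotient is_boundary.
HB.instance Definition _ := GRing.Lmodule.on homology.

Definition hclass : ker d' -> homology := @proj _ _ is_boundary.

Lemma hclass_linear : linear hclass. Proof. exact: proj_linear. Qed.
HB.instance Definition _ := GRing.isLinear.Build R (ker d') homology *:%R hclass
  hclass_linear.

Definition hrepr (c : homology) : ker d' := repr (c : quotient is_boundary).

Lemma hclassK c : hclass (hrepr c) = c. Proof. exact: projK. Qed.

Lemma hclassP x y : hclass x = hclass y <-> exists u, d u = val x - val y.
Proof. by split=> [/projP/asboolP[u]|[u ux]]; [exists u | apply/projP/asboolP; exists u]. Qed.

Lemma hclass_eq0 x : hclass x = 0 <-> exists u, d u = val x.
Proof.
have {1}<- : hclass 0 = 0 by exact: raddf0.
have -> : val x = val x - val (0 : ker d') by rewrite [val 0]raddf0 subr0.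
exact: hclassP.
Qed.

End Homology.

Arguments hclass {R U V W} d d' z.

(* The scalars R, as values, are written R^o, i.e. R as a module over itself;
   the space of n-cochains of G is cochain R (G * ... * G). *)
Definition cochain (R : realType) (T : Type) := T -> R^o.
HB.instance Definition _ (R : realType) (T : Type) :=
  GRing.Lmodule.copy (cochain R T) (T -> R^o).

Section Bounded.
Variables (R : realType) (T : Type).

Definition bounded_map (f : cochain R T) : Prop :=
  exists M : R, forall x, `|f x| <= M.

Definition is_bounded : {pred cochain R T} := fun f => `[< bounded_map f >].

Lemma is_bounded_closed : subsemimod_closed is_bounded.
Proof.
split; first split.
- by apply/asboolP; exists 0 => x; rewrite normr0.
- move=> f g /asboolP[M fM] /asboolP[N gN]; apply/asboolP; exists (M + N) => x.
  by apply: (le_trans (ler_normD _ _)); apply: lerD.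
- move=> a f /asboolP[M fM]; apply/asboolP; exists (`|a| * M) => x.
  by rewrite normrM ler_wpM2l.
Qed.
HB.instance Definition _ :=
  GRing.isSubmodClosed.Build R (cochain R T) is_bounded is_bounded_closed.

Definition bcochain := subspace is_bounded.
HB.instance Definition _ := GRing.SubLmodule.on bcochain.

End Bounded.

Section BoundedCohomology.
Variables (R : realType) (G : groupType).

Local Notation C1 := (cochain R G).
Local Notation C2 := (cochain R (G * G)).
Local Notation C3 := (cochain R (G * G * G)).
Local Notation C1b := (bcochain R G).
Local Notation C2b := (bcochain R (G * G)).
Local Notation C3b := (bcochain R (G * G * G)).

Definition cobound1 (f : C1) : C2 :=
  fun p => let: (x, y) := p in f y - f (x * y)%g + f x.

Definition cobound2 (f : C2) : C3 :=
  fun p => let: (x, y, z) := p in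
    f (y, z) - f ((x * y)%g, z) + f (x, (y * z)%g) - f (x, y).

Lemma cobound1_linear : linear cobound1.
Proof.
move=> a f g; apply/funext => -[x y].
rewrite -[LHS]/((a * f y + g y) - (a * f (x * y)%g + g (x * y)%g)
                + (a * f x + g x) : R).
rewrite -[RHS]/(a * (f y - f (x * y)%g + f x)
                + (g y - g (x * y)%g + g x) : R).
ring.
Qed.
HB.instance Definition _ := GRing.isLinear.Build R C1 C2 *:%R cobound1
  cobound1_linear.

Lemma cobound2_linear : linear cobound2.
Proof.
move=> a f g; apply/funext => -[[x y] z].
rewrite -[LHS]/((a * f (y, z) + g (y, z))
  - (a * f ((x * y)%g, z) + g ((x * y)%g, z))
  + (a * f (x, (y * z)%g) + g (x, (y * z)%g)) - (a * f (x, y) + g (x, y)) : R).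
rewrite -[RHS]/(a * (f (y, z) - f ((x * y)%g, z) + f (x, (y * z)%g) - f (x, y))
  + (g (y, z) - g ((x * y)%g, z) + g (x, (y * z)%g) - g (x, y)) : R).
ring.
Qed.
HB.instance Definition _ := GRing.isLinear.Build R C2 C3 *:%R cobound2
  cobound2_linear.

Lemma cobound2K f : cobound2 (cobound1 f) = 0.
Proof.
apply/funext => -[[x y] z]; rewrite /cobound2 /cobound1 mulgA.
rewrite -[RHS]/(0 : R).
rewrite -[LHS]/((f z - f (y * z)%g + f y) - (f z - f (x * y * z)%g + f (x * y)%g)
  + (f (y * z)%g - f (x * y * z)%g + f x) - (f y - f (x * y)%g + f x) : R).
ring.
Qed.

Lemma cobound1_bounded (f : C1b) : cobound1 (val f) \in @is_bounded R (G * G).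
Proof.
case: f => f /= /asboolP[M fM]; apply/asboolP; exists (M + M + M) => -[x y] /=.
rewrite (le_trans (ler_normD _ _)) ?lerD //.
by rewrite (le_trans (ler_normB _ _)) ?lerD.
Qed.

Lemma cobound2_bounded (f : C2b) :
  cobound2 (val f) \in @is_bounded R (G * G * G).
Proof.
case: f => f /= /asboolP[M fM]; apply/asboolP.
exists (M + M + M + M) => -[[x y] z] /=.
rewrite (le_trans (ler_normB _ _)) ?lerD //.
rewrite (le_trans (ler_normD _ _)) ?lerD //.
by rewrite (le_trans (ler_normB _ _)) ?lerD.
Qed.

Definition bcobound1 (f : C1b) : C2b :=
  exist _ (cobound1 (val f)) (cobound1_bounded f).

Definition bcobound2 (f : C2b) : C3b :=
  exist _ (cobound2 (val f)) (cobound2_bounded f).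

Lemma bcobound1_linear : linear bcobound1.
Proof. by move=> a f g; apply: val_inj; rewrite /= linearP. Qed.
HB.instance Definition _ := GRing.isLinear.Build R C1b C2b *:%R bcobound1
  bcobound1_linear.

Lemma bcobound2_linear : linear bcobound2.
Proof. by move=> a f g; apply: val_inj; rewrite /= linearP. Qed.
HB.instance Definition _ := GRing.isLinear.Build R C2b C3b *:%R bcobound2
  bcobound2_linear.

Definition H2 := homology cobound1 cobound2.
HB.instance Definition _ := GRing.Lmodule.on H2.

Definition H2b := homology bcobound1 bcobound2.
HB.instance Definition _ := GRing.Lmodule.on H2b.

Lemma forget_bounded_subproof (z : ker bcobound2) :
  val (val z) \in in_ker cobound2.
Proof.
case: z => z zker /=; have /eqP zP := zker; rewrite in_kerE; apply/eqP.
by have /= -> := congr1 val zP.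
Qed.

Definition forget_bounded (z : ker bcobound2) : ker cobound2 :=
  exist _ (val (val z)) (forget_bounded_subproof z).

(* By compare_hclass, this is the map induced by forget_bounded. *)
Definition compare (c : H2b) : H2 := hclass _ _ (forget_bounded (hrepr c)).

Lemma compare_hclass z :
  compare (hclass _ _ z) = hclass _ _ (forget_bounded z).
Proof.
have /hclassP[u uP] := hclassK (hclass bcobound1 bcobound2 z).
apply/hclassP; exists (val u).
by have := congr1 val uP; rewrite raddfB.
Qed.

Lemma forget_bounded_linear : linear forget_bounded.
Proof.
by move=> a x y; apply: val_inj; rewrite linearP /=.
Qed.
HB.instance Definition _ := GRing.isLinear.Build R (ker bcobound2)
  (ker cobound2) *:%R forget_bounded forget_bounded_linear.

Lemma compare_linear : linear compare.
Proof.
move=> a c d.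
have -> : a *: c + d = hclass _ _ (a *: hrepr c + hrepr d).
  by rewrite hclass_linear !hclassK.
by rewrite compare_hclass forget_bounded_linear hclass_linear.
Qed.
HB.instance Definition _ := GRing.isLinear.Build R H2b H2 *:%R compare
  compare_linear.

Definition EH2b := ker compare.
HB.instance Definition _ := GRing.SubLmodule.on EH2b.

Definition quasimorphism (f : G -> R) : Prop :=
  exists D : R, forall x y, `|f x + f y - f (x * y)%g| <= D.

Section CoboundaryOfQuasimorphism.
Variables (f : C1) (fq : quasimorphism f).

Lemma qm_cobound_bounded : cobound1 f \in @is_bounded R (G * G).
Proof.
case: fq => D fD; apply/asboolP; exists D => -[x y] /=.
by rewrite addrAC [f y + _]addrC.
Qed.

Definition qm_cobound : C2b := exist _ (cobound1 f) qm_cobound_bounded.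

Lemma qm_cobound_cocycle : qm_cobound \in in_ker bcobound2.
Proof. by rewrite in_kerE; apply/eqP/val_inj; rewrite /= cobound2K. Qed.

Definition qm_cocycle : ker bcobound2 := exist _ qm_cobound qm_cobound_cocycle.

Lemma qm_class_exact : hclass _ _ qm_cocycle \in in_ker compare.
Proof.
rewrite in_kerE; apply/eqP; apply: (etrans (compare_hclass _)).
by apply/hclass_eq0; exists f.
Qed.

Definition qm_class : EH2b := exist _ (hclass _ _ qm_cocycle) qm_class_exact.

End CoboundaryOfQuasimorphism.

End BoundedCohomology.

(* An element of the free product of the G s is encoded by its factorization,
   the letter existT _ s p standing for p in G s; see freeprod_factorization
   and freeprod_universal below. *)
Section FreeProduct.
Local Open Scope group_scope.
Variables (S : choiceType) (G : S -> groupType).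

Local Notation letter := {s : S & G s}.
Implicit Types (s t : S) (a b : letter) (w u v : seq letter).

Definition alternating w := sorted (fun a b => tag a != tag b) w.
Definition reduced w := all (fun a => tagged a != 1) w && alternating w.

Definition freeprod := {w : seq letter | reduced w}.
HB.instance Definition _ := SubChoice.on freeprod.

(* split_letter s w removes from w its leading letter if it lies in G s, and
   returns this letter (1 if there is none) and the rest of w. *)
Definition split_letter s w : G s * seq letter :=
  if w is a :: w' then
    if tag a == s then (tagged_as (existT G s 1) a, w') else (1, w)
  else (1, [::]).

Definition cons_letter s (p : G s) w : seq letter :=
  if p == 1 then w else existT G s p :: w.

(* Left multiplication of a reduced word by a letter (van der Waerden). *)
Definition act_letter a w : seq letter :=
  let: (q, w') := split_letter (tag a) w in cons_letter (tagged a * q) w'.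

Definition mul_word u v := foldr act_letter v u.
Definition inv_letter a : letter := existT G (tag a) (tagged a)^-1.
Definition inv_word w := rev (map inv_letter w).

Definition head_not s w := if w is a :: _ then tag a != s else true.

Lemma reduced_cons a w :
  reduced (a :: w) = [&& tagged a != 1, head_not (tag a) w & reduced w].
Proof.
rewrite /reduced /alternating /=; case: w => [|b w] /=; first by rewrite !andbT.
by rewrite -andbA; congr andb; rewrite andbCA eq_sym.
Qed.

Lemma split_letter_cons s (q : G s) w :
  split_letter s (existT G s q :: w) = (q, w).
Proof.
by rewrite /= eqxx /tagged_as /=; case: eqP => // e; rewrite eq_axiomK.
Qed.

Lemma cons_letterK s (p : G s) w :
  head_not s w -> split_letter s (cons_letter p w) = (p, w).
Proof.
rewrite /cons_letter; case: eqP => [-> |_] sw /=.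
  by case: w sw => //= a w; case: eqP.
exact: split_letter_cons.
Qed.

Lemma split_letterK s w : reduced w ->
  [/\ cons_letter (split_letter s w).1 (split_letter s w).2 = w,
      head_not s (split_letter s w).2 & reduced (split_letter s w).2].
Proof.
case: w => [|[t q] w]; first by rewrite /cons_letter /= eqxx.
rewrite reduced_cons /= => /and3P[q1 tw rw].
case: eqP => [e|/eqP ts]; last first.
  by rewrite /cons_letter eqxx /= reduced_cons ts /= q1 tw.
case: s / e; rewrite /tagged_as /=; case: eqP => // e.
by rewrite eq_axiomK /= /cons_letter (negPf q1).
Qed.

Lemma reduced_cons_letter s (p : G s) w :
  head_not s w -> reduced w -> reduced (cons_letter p w).
Proof.
by rewrite /cons_letter; case: eqP => // /eqP p1 sw rw; rewrite reduced_cons p1 sw.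
Qed.

Lemma act_letterE s p w : act_letter (existT G s p) w =
  cons_letter (p * (split_letter s w).1) (split_letter s w).2.
Proof. by rewrite /act_letter /=; case: split_letter. Qed.

Lemma reduced_act a w : reduced w -> reduced (act_letter a w).
Proof.
by case: a => s p /(split_letterK s)[_ ? ?]; rewrite act_letterE reduced_cons_letter.
Qed.

Lemma act_letterM s (p q : G s) w : reduced w ->
  act_letter (existT G s p) (act_letter (existT G s q) w) =
  act_letter (existT G s (p * q)) w.
Proof.
by case/(split_letterK s) => _ ? _; rewrite !act_letterE cons_letterK //= mulgA.
Qed.

Lemma act_letter1 s w : reduced w -> act_letter (existT G s 1) w = w.
Proof. by case/(split_letterK s) => e _ _; rewrite act_letterE mul1g. Qed.

Lemma act_cons a w : reduced (a :: w) -> act_letter a w = a :: w.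
Proof.
case: a => s p; rewrite reduced_cons act_letterE /= => /and3P[p1 sw _].
have -> : split_letter s w = (1, w) by case: w sw => //= b w; case: eqP.
by rewrite /= mulg1 /cons_letter (negPf p1).
Qed.

Lemma reduced_mul u v : reduced v -> reduced (mul_word u v).
Proof. by move=> rv; elim: u => //= a u; apply: reduced_act. Qed.

Lemma mul_word_cat u v : reduced (u ++ v) -> mul_word u v = u ++ v.
Proof.
elim: u => //= a u IHu ruv; rewrite IHu ?act_cons //.
by move: ruv; rewrite reduced_cons => /and3P[].
Qed.

Lemma reduced_cat u a v :
  reduced (u ++ a :: v) = reduced (rcons u a) && reduced (a :: v).
Proof.
elim: u => [|b u IHu] /=; first by rewrite !reduced_cons; case: (tagged a != 1).
rewrite !(reduced_cons b) IHu -!andbA; congr (_ && (_ && _)).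
by case: u {IHu}.
Qed.

Lemma reduced_rcons_eq_tag u a b : tag b = tag a -> tagged b != 1 ->
  reduced (rcons u a) -> reduced (rcons u b).
Proof.
move=> tab b1; elim: u => [|c u IHu] /=; first by rewrite !reduced_cons b1.
rewrite !reduced_cons => /and3P[-> h /IHu ->]; rewrite andbT /=.
by case: u h {IHu} => //=; rewrite tab.
Qed.

Lemma reduced_belast u a : reduced (rcons u a) -> reduced u.
Proof.
elim: u => [|b u IHu] //=; rewrite !reduced_cons => /and3P[-> h /IHu ->].
by case: u h {IHu} => //= c u ->.
Qed.

Lemma reduced_last u a : reduced (rcons u a) -> tagged a != 1.
Proof. by case/andP; rewrite all_rcons => /andP[]. Qed.

Lemma mul_word_act a u w : reduced u -> reduced w ->
  mul_word (act_letter a u) w = act_letter a (mul_word u w).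
Proof.
case: a => s p ru rw.
have [eu _ _] := split_letterK s ru.
have E (q : G s) x :
    mul_word (cons_letter q x) w = act_letter (existT G s q) (mul_word x w).
  rewrite /cons_letter; case: eqP => // ->.
  by rewrite act_letter1 // reduced_mul.
by rewrite -[in RHS]eu act_letterE !E act_letterM // reduced_mul.
Qed.

Lemma mul_wordA u v w : reduced v -> reduced w ->
  mul_word u (mul_word v w) = mul_word (mul_word u v) w.
Proof.
move=> rv rw; elim: u => //= a u ->.
by rewrite mul_word_act // reduced_mul.
Qed.

Lemma reduced_inv w : reduced w -> reduced (inv_word w).
Proof.
case/andP=> w1 sw; apply/andP; split.
  rewrite /inv_word all_rev all_map; apply: sub_all w1 => a /=.
  by rewrite -[X in _ -> _ != X]invg1 (inj_eq invg_inj).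
rewrite /alternating /inv_word rev_sorted sorted_map.
by move: sw; apply: sub_sorted => a b; rewrite /= eq_sym.
Qed.

Lemma mul_word_inv w : reduced w -> mul_word (inv_word w) w = [::].
Proof.
elim: w => // a w IHw raw; have rw : reduced w.
  by move: raw; rewrite reduced_cons => /and3P[].
rewrite /inv_word /= rev_cons /mul_word foldr_rcons -/(mul_word _ _).
rewrite -(act_cons raw); case: a {raw} => s p.
by rewrite [act_letter _ (act_letter _ _)]act_letterM //= mulVg act_letter1 // IHw.
Qed.

Lemma inv_wordK w : inv_word (inv_word w) = w.
Proof.
rewrite /inv_word map_rev revK -map_comp map_id_in // => -[s p] _ /=.
by rewrite /inv_letter /= invgK.
Qed.

Definition freeprod_one : freeprod := exist _ [::] isT.
Definition freeprod_mul (x y : freeprod) : freeprod :=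
  exist _ (mul_word (val x) (val y)) (reduced_mul (val x) (valP y)).
Definition freeprod_inv (x : freeprod) : freeprod :=
  exist _ (inv_word (val x)) (reduced_inv (valP x)).

Lemma freeprod_mulA : associative freeprod_mul.
Proof. by move=> x y z; apply: val_inj; rewrite /= mul_wordA // valP. Qed.

Lemma freeprod_mul1 : left_id freeprod_one freeprod_mul.
Proof. by move=> x; apply: val_inj. Qed.

Lemma freeprod_mulr1 : right_id freeprod_one freeprod_mul.
Proof.
move=> x; apply: val_inj; rewrite /= mul_word_cat cats0 //; exact: valP.
Qed.

Lemma freeprod_mulV : left_inverse freeprod_one freeprod_inv freeprod_mul.
Proof. by move=> x; apply: val_inj; rewrite /= mul_word_inv // valP. Qed.

Lemma freeprod_mulrV : right_inverse freeprod_one freeprod_inv freeprod_mul.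
Proof.
move=> x; apply: val_inj; rewrite /= -{1}[val x]inv_wordK mul_word_inv //.
exact: reduced_inv (valP x).
Qed.

HB.instance Definition _ := isGroup.Build freeprod freeprod_mulA
  freeprod_mul1 freeprod_mulr1 freeprod_mulV freeprod_mulrV.

Lemma freeprod_in_subproof s (p : G s) : reduced (cons_letter p [::]).
Proof. exact: reduced_cons_letter. Qed.

Definition freeprod_in s (p : G s) : freeprod :=
  exist _ (cons_letter p [::]) (freeprod_in_subproof p).

Lemma freeprod_in_morphism s : monoid.monoid_morphism (@freeprod_in s).
Proof.
split=> [|p q]; apply: val_inj; first by rewrite /= /cons_letter eqxx.
have E (r : G s) : val (freeprod_in r) = act_letter (existT G s r) [::].
  by rewrite act_letterE /= mulg1.
rewrite E -act_letterM // -E /=; rewrite {2}/cons_letter; case: eqP => //= ->.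
by rewrite act_letter1 // freeprod_in_subproof.
Qed.
HB.instance Definition _ s := isUMagmaMorphism.Build (G s) freeprod
  (@freeprod_in s) (freeprod_in_morphism s).

Lemma freeprod_in_inj s : injective (@freeprod_in s).
Proof.
move=> p q /(congr1 (fun x => (split_letter s (val x)).1)).
by rewrite !cons_letterK.
Qed.

Lemma freeprod_factorization (x : freeprod) :
  x = \prod_(a <- val x) freeprod_in (tagged a).
Proof.
case: x => w /= rw; apply: val_inj => /=.
elim: w rw => [|a w IHw] raw; first by rewrite big_nil.
have [a1 aw rw] : [/\ tagged a != 1, head_not (tag a) w & reduced w].
  by move: raw; rewrite reduced_cons => /and3P[].
rewrite big_cons [val _]/= -IHw // {1}/cons_letter (negPf a1) /=.
by case: a raw {a1 aw} => s p /act_cons.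
Qed.

Lemma freeprod_universal (H : groupType)
    (f : forall s, UMagmaMorphism.type (G s) H) :
  exists! F : freeprod -> H,
    monoid.monoid_morphism F /\ forall s p, F (@freeprod_in s p) = f s p.
Proof.
pose F w : H := \prod_(a <- w) f (tag a) (tagged a).
have F_cons s p w : F (@cons_letter s p w) = f s p * F w.
  rewrite /cons_letter; case: eqP => [->|_]; last by rewrite /F big_cons.
  by rewrite gmulf1 mul1g.
have F_act a w : reduced w -> F (act_letter a w) = f (tag a) (tagged a) * F w.
  case: a => s p /(split_letterK s)[e _ _]; rewrite -[in RHS]e.
  by rewrite act_letterE !F_cons gmulfM mulgA.
have F_mul u v : reduced v -> F (mul_word u v) = F u * F v.
  move=> rv; elim: u => [|a u IHu] /=; first by rewrite /F big_nil mul1g.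
  by rewrite F_act ?reduced_mul // IHu mulgA [F (a :: u)]big_cons.
exists (fun x => F (val x)); split.
  split=> [|s p]; last by rewrite F_cons /F big_nil mulg1.
  by split=> [|x y]; rewrite ?[LHS]F_mul ?(valP y) // /F big_nil.
move=> F' [[F'1 F'M] F'in]; apply/funext => x.
rewrite [in RHS](freeprod_factorization x) (big_morph F' F'M F'1).
by apply: eq_bigr => a _; rewrite F'in.
Qed.

End FreeProduct.

Section SupNorm.
Variables (R : realType) (H : groupType).

Definition odd_map (f : H -> R) : Prop := forall x, f (x^-1)%g = - f x.

Definition is_bounded_odd : {pred cochain R H} :=
  fun f => `[< bounded_map f /\ odd_map f >].

Lemma is_bounded_odd_closed : subsemimod_closed is_bounded_odd.
Proof.
have E f : (f \in is_bounded_odd) = (f \in @is_bounded R H) && `[< odd_map f >].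
  by rewrite -asbool_and.
split; first split.
- rewrite E rpred0 /=; apply/asboolP => x; exact/esym/oppr0.
- move=> f g; rewrite !E => /andP[fb /asboolP fo] /andP[gb /asboolP go].
  rewrite rpredD //=; apply/asboolP => x.
  by rewrite -[LHS]/(f (x^-1)%g + g (x^-1)%g) fo go [RHS]opprD.
- move=> a f; rewrite !E => /andP[fb /asboolP fo].
  rewrite rpredZ //=; apply/asboolP => x.
  by rewrite -[LHS]/(a * f (x^-1)%g) fo [LHS]mulrN.
Qed.
HB.instance Definition _ := GRing.isSubmodClosed.Build R (cochain R H)
  is_bounded_odd is_bounded_odd_closed.

Definition bounded_odd := subspace is_bounded_odd.
HB.instance Definition _ := GRing.SubLmodule.on bounded_odd.

Definition supnorm (f : H -> R) : R := sup [set `|f x| | x in [set: H]].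

Lemma supnorm_ub (f : bounded_odd) x : `|val f x| <= supnorm (val f).
Proof.
case: f => f /= /asboolP[[M fM] _].
apply: ub_le_sup; last by exists x.
by exists M => _ [y _ <-].
Qed.

Lemma supnorm_le (f : H -> R) M : (forall x, `|f x| <= M) -> supnorm f <= M.
Proof.
move=> fM; apply: ge_sup; last by move=> _ [x _ <-].
by exists `|f 1%g|, 1%g.
Qed.

End SupNorm.

Section FreeProductMap.
Variables (R : realType) (S : choiceType) (G : S -> groupType).

Definition V := dprod (fun s => bounded_odd R (G s)).
HB.instance Definition _ := GRing.Lmodule.on V.

Definition is_unif_bounded : {pred V} := fun sigma =>
  `[< has_ubound [set supnorm (val (sigma s)) | s in [set: S]] >].

Lemma is_unif_bounded_closed : subsemimod_closed is_unif_bounded.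
Proof.
split; first split.
- apply/asboolP; exists 0 => _ [s _ <-].
  by apply: supnorm_le => x; rewrite normr0.
- move=> f g /asboolP[M fM] /asboolP[N gN]; apply/asboolP.
  exists (M + N) => _ [s _ <-]; apply: supnorm_le => x.
  apply: (le_trans (ler_normD _ _)); apply: lerD.
    by apply: (le_trans (supnorm_ub _ _)); apply: fM; exists s.
  by apply: (le_trans (supnorm_ub _ _)); apply: gN; exists s.
- move=> a f /asboolP[M fM]; apply/asboolP.
  exists (`|a| * M) => _ [s _ <-]; apply: supnorm_le => x.
  rewrite [X in X <= _]normrM ler_wpM2l //.
  by apply: (le_trans (supnorm_ub _ _)); apply: fM; exists s.
Qed.
HB.instance Definition _ := GRing.isSubmodClosed.Build R V
  is_unif_bounded is_unif_bounded_closed.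

Definition V0 := subspace is_unif_bounded.
HB.instance Definition _ := GRing.SubLmodule.on V0.

Lemma V0_bounded (sigma : V0) : exists2 M : R, 0 <= M &
  forall s x, `|(val (val sigma s) : G s -> R) x| <= M.
Proof.
case: sigma => sigma /= /asboolP[M sM]; exists `|M| => // s x.
apply: (le_trans (supnorm_ub _ _)); apply: (le_trans _ (ler_norm M)).
by apply: sM; exists s.
Qed.

Lemma V0_odd (sigma : V0) s x :
  (val (val sigma s) : G s -> R) (x^-1)%g = - (val (val sigma s) : G s -> R) x.
Proof. by case: sigma => sigma _ /=; case: (sigma s) => f /= /asboolP[_ ->]. Qed.

Definition g_word (sigma : V0) (w : seq {s : S & G s}) : R :=
  \sum_(a <- w) (val (val sigma (tag a)) : G (tag a) -> R) (tagged a).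

(* val x is the factorization of x. *)
Definition g (sigma : V0) (x : freeprod G) : R := g_word sigma (val x).

Lemma g_quasimorphism (sigma : V0) : quasimorphism (g sigma).
Proof.
have [M M0 sM] := V0_bounded sigma; exists (M + M + M) => -[u ru] [v rv].
rewrite /g /=; elim/last_ind: u v ru rv => [|u [s p] IHu] v rup rv.
  by rewrite /g_word big_nil add0r subrr normr0 !addr_ge0.
have E w a t : g_word sigma (w ++ a :: t) =
    g_word sigma w + (val (val sigma (tag a)) (tagged a) + g_word sigma t).
  by rewrite /g_word big_cat big_cons.
have E0 : g_word sigma [::] = 0 by rewrite /g_word big_nil.
have concat w t : reduced (w ++ t) ->
    `|g_word sigma w + g_word sigma t - g_word sigma (mul_word w t)| <= M + M + M.
  move=> rwt; rewrite mul_word_cat // /g_word big_cat subrr normr0.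
  by rewrite !addr_ge0.
case: v rv => [|[t q] v] rv; first by apply: concat; rewrite cats0.
have [est|nst] := eqVneq s t; last first.
  apply: concat; rewrite cat_rcons reduced_cat rup reduced_cons rv /=.
  by rewrite [t == s]eq_sym nst /= !andbT; exact: reduced_last rup.
case: t / est q rv => q rv.
have -> : mul_word (rcons u (existT G s p)) (existT G s q :: v) =
    mul_word u (cons_letter (p * q)%g v).
  rewrite /mul_word foldr_rcons -/(mul_word _ _) act_letterE.
  by rewrite split_letter_cons.
have rv' : reduced v by move: rv; rewrite reduced_cons => /and3P[].
rewrite -cats1 -[_ :: v]cat0s !E E0 !add0r addr0 /cons_letter.
case: eqP => [pq|/eqP pq].
  have -> : q = (p^-1)%g by apply: (mulgI p); rewrite pq mulgV.
  rewrite V0_odd.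
  have -> (x y z t : R) : x + y + (- y + z) - t = x + z - t by ring.
  exact: IHu (reduced_belast rup) rv'.
rewrite mul_word_cat; last first.
  rewrite reduced_cat (reduced_rcons_eq_tag _ _ rup) //= reduced_cons /= pq rv'.
  by move: rv; rewrite reduced_cons => /and3P[_ -> _].
rewrite E /=.
have -> (x y z t m : R) : x + y + (z + t) - (x + (m + t)) = y + z - m by ring.
apply: (le_trans (ler_normB _ _)); apply: lerD; last exact: sM.
by apply: (le_trans (ler_normD _ _)); apply: lerD; exact: sM.
Qed.

Definition g_class (sigma : V0) : EH2b R (freeprod G) :=
  qm_class (g_quasimorphism sigma).

End FreeProductMap.

(* Main.v *)
Require Import Defs.
From HB Require Import structures.
From mathcomp Require Import all_boot all_order all_algebra.
From mathcomp Require Import all_classical reals.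
From mathcomp Require Import lra.
Import Order.TTheory GRing.Theory Num.Theory.
Local Open Scope ring_scope.

(** Linearity already holds for the quasi-morphisms: [g sigma] is a sum of
    values of [sigma] over the factorization, hence linear in [sigma]
    ([g_linear]).

    For injectivity, suppose that the coboundary of [g sigma] is also that of a
    bounded map [f], so that [h = g sigma - f] is a homomorphism to the reals.
    The values of [h] are slopes of [g sigma] along powers, because the bounded
    error [f] disappears in the limit ([slope_unique]).  On a factor [g sigma]
    is bounded, so [h] vanishes there.  On the other hand, take [p] and [q]
    nontrivial in two different factors: the word [p q p q^-1] is cyclically
    reduced, so that its powers are factored by mere repetition and [g sigma]
    is homogeneous on them ([g_expg]), with slope
    [sigma p + sigma q + sigma p - sigma q = 2 sigma p], by oddness.  Therefore
    [2 sigma p = h (p q p q^-1) = 2 h p = 0].  The shorter word [p q] would only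
    give [sigma p + sigma q = 0]; inserting [q^-1] cancels the contribution of
    [q]. *)

(** A nonzero difference [h x - c] would be multiplied by [n] on [x ^+ n], hence
    be unbounded. *)
Lemma slope_unique (R : realType) (H : groupType) (h : H -> R) (x : H)
    (c M : R) :
  (forall y z, h (y * z)%g = h y + h z) ->
  (forall n, `|h (x ^+ n)%g - c *+ n| <= M) -> h x = c.
Proof.
move=> hM hb; apply/eqP; rewrite -subr_eq0; apply/negPn/negP => nz.
have hX n : h (x ^+ n)%g = h x *+ n.
  elim: n => [|n IHn]; last by rewrite expgS hM IHn mulrS.
  by rewrite expg0 mulr0n; apply: (addrI (h 1%g)); rewrite -hM mul1g addr0.
have d0 : 0 < `|h x - c| by rewrite normr_gt0.
have := hb (Num.truncn (M / `|h x - c|)).+1.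
rewrite hX -mulrnBl normrMn -mulr_natr -ler_pdivlMl //.
by rewrite mulrC leNgt truncnS_gt.
Qed.

Section FreeProductQuasimorphism.
Context {R : realType} {S : choiceType} {G : S -> groupType}.
Implicit Types (sigma tau : V0 R G) (x : freeprod G).

(** The value of [sigma] at a letter. *)
Local Notation coef sigma s p := ((val (val sigma s) : G s -> R) p).

Lemma coef1 sigma s : coef sigma s 1%g = 0.
Proof.
by have /esym/eqP := V0_odd sigma (1%g : G s); rewrite invg1 eqNr => /eqP.
Qed.

Lemma g_in sigma s (p : G s) : g sigma (freeprod_in p) = coef sigma s p.
Proof.
rewrite /g /g_word /= /cons_letter; case: eqP => [->|_].
  by rewrite big_nil coef1.
by rewrite big_seq1.
Qed.

Lemma g_linear a sigma tau :
  g (a *: sigma + tau) = a *: (g sigma : cochain R (freeprod G)) + g tau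
    :> cochain R (freeprod G).
Proof.
apply/funext => x; rewrite -[RHS]/(a * g sigma x + g tau x).
by rewrite /g /g_word mulr_sumr -big_split.
Qed.

(** If the factorization of [x] can be repeated once without cancellation or
    merging at the junction, it can be repeated any number of times. *)
Lemma g_expg sigma x n : reduced (val x ++ val x) ->
  g sigma (x ^+ n)%g = g sigma x *+ n.
Proof.
move=> rxx; have E m : val (x ^+ m)%g = flatten (nseq m (val x)) /\
    reduced (val x ++ flatten (nseq m (val x))).
  elim: m => [|m [IHm IHr]]; first by rewrite expg0 cats0 (valP x).
  rewrite expgS; split.
    by rewrite -[LHS]/(mul_word (val x) (val (x ^+ m)%g)) IHm mul_word_cat.
  case: (val x) rxx IHr => [|a w]; first by [].
  rewrite /= -!cat_cons !reduced_cat => /andP[-> _].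
  by rewrite -cat_cons.
rewrite /g (E n).1 /g_word; elim: n {E} => [|n IHn]; first by rewrite big_nil.
by rewrite /= big_cat IHn mulrS.
Qed.

(** The additive map is [h = g sigma - f], compared with [g sigma] on the powers
    of the letters and of the word [p q p q^-1]. *)
Lemma g_class_eq0 sigma : (exists s t : S, s <> t) ->
  (forall s : S, exists x : G s, x <> 1%g) -> g_class sigma = 0 -> sigma = 0.
Proof.
move=> [s1 [s2 s12]] ntG /(congr1 val) /hclass_eq0[[f /= fb] /(congr1 val) /= fE].
have /asboolP[M fM] := fb.
pose h y : R := g sigma y - f y.
have hM y z : h (y * z)%g = h y + h z.
  have E : f z - f (y * z)%g + f y
      = g sigma z - g sigma (y * z)%g + g sigma y :> R.
    by have := congr1 (fun F => F (y, z)) fE.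
  rewrite /h; lra.
have [N N0 sN] := V0_bounded sigma.
have h_in s (p : G s) : h (freeprod_in p) = 0.
  apply: (@slope_unique _ _ h _ 0 (N + M)) => // n.
  rewrite mul0rn subr0 -gmulfXn /h g_in.
  by rewrite (le_trans (ler_normB _ _)) // lerD.
have coef0 s (p : G s) : coef sigma s p = 0.
  have [->|p1] := eqVneq p 1%g; first exact: coef1.
  have [t ts] : exists t, t != s.
    have [e|] := eqVneq s1 s; last by exists s1.
    by exists s2; apply/eqP => e'; case: s12; rewrite e e'.
  have [q /eqP q1] := ntG t.
  have q1' : (q^-1)%g != 1%g by rewrite -invg1 (inj_eq invg_inj).
  pose w := [:: existT G s p; existT G t q; existT G s p; existT G t (q^-1)%g].
  have rww : reduced (w ++ w).
    by rewrite /w !reduced_cons /= p1 q1 q1' ts eq_sym ts.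
  have rw : reduced w.
    by rewrite /w !reduced_cons /= p1 q1 q1' ts eq_sym ts.
  pose x : freeprod G := exist _ w rw.
  have xE : x = (freeprod_in p * freeprod_in q
                 * (freeprod_in p * freeprod_in q^-1))%g.
    by rewrite [LHS]freeprod_factorization /= !big_cons big_nil mulg1 !mulgA.
  have gx : g sigma x = coef sigma s p *+ 2.
    rewrite /g /g_word /= !big_cons big_nil /= V0_odd.
    by rewrite addr0 [coef sigma t q + _]addrC subrK mulr2n.
  have : h x = coef sigma s p *+ 2.
    apply: (@slope_unique _ _ h x _ M) => // n.
    by rewrite /h g_expg // gx addrAC subrr sub0r normrN.
  rewrite xE !hM !h_in !addr0 => /esym/eqP.
  by rewrite mulrn_eq0 => /eqP.
apply: val_inj; apply: functional_extensionality_dep => s.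
by apply: val_inj; apply/funext => p; exact: coef0.
Qed.

Lemma g_class_linear : linear (@g_class R S G : V0 R G -> EH2b R (freeprod G)).
Proof.
move=> a sigma tau; apply: val_inj; rewrite linearP /= -hclass_linear.
congr hclass; apply: val_inj; rewrite linearP /=; apply: val_inj.
by rewrite linearP /= g_linear linearP.
Qed.

End FreeProductQuasimorphism.

Theorem mainTheorem6 (R : realType) (S : choiceType) (G : S -> groupType)
    (card_S : exists s t : S, s <> t)
    (nontrivial_G : forall s : S, exists x : G s, x <> 1%g) :
  linear (@g_class R S G : V0 R G -> EH2b R (freeprod G)) /\
  injective (@g_class R S G : V0 R G -> EH2b R (freeprod G)).
Proof.
split=> [|sigma tau e]; first exact: g_class_linear.
apply/eqP; rewrite -subr_eq0; apply/eqP/g_class_eq0 => //.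
by rewrite addrC -scaleN1r g_class_linear e scaleN1r addNr.
Qed.
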